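(* There is an absolute constant $C>0$ such that the following holds. For each $n$, let $A$ be a set of $n$ random points chosen independently and uniformly from the unit square $[0,1]^2$. Then, with probability tending to $1$ as $n\to\infty$, the edge set of the complete geometric graph $K_n[A]$ can be covered by at most $C\,n\log n$ monotone paths.
   Context: A set of points in the plane is in general position if no three of its points are collinear (a random set $A$ as in the claim is in general position with probability $1$). For an $n$-point set $A$ in general position in the plane, the complete geometric graph $K_n[A]$ has vertex set $A$, and its edges are all $\binom n2$ straight-line segments between points of $A$. A polygonal path $\xi=(v_1,v_2,\ldots,v_t)$ in $\mathbb{R}^2$ is monotone in direction $\mathbf{u}\in\mathbb{R}^2\setminus\{\mathbf{0}\}$ if $\langle \overrightarrow{v_iv_{i+1}},\mathbf{u}\rangle>0$ for $i=1,\ldots,t-1$. A path is monotone if it is monotone in some direction $\mathbf{u}\in\mathbb{R}^2\setminus\{\mathbf{0}\}$. The paths are paths in $K_n[A]$, drawn with straight-line edges. A family of paths covers the edge set of $K_n[A]$ if every edge of $K_n[A]$ belongs to at least one path of the family. Logarithms are in base $2$. *)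

(* Defs.v *)
From HB Require Import structures.
From mathcomp Require Import all_boot all_order all_algebra.
From mathcomp Require Import all_classical all_reals all_analysis.

Set Implicit Arguments.
Unset Strict Implicit.
Unset Printing Implicit Defensive.

Import Order.TTheory GRing.Theory Num.Theory.
Import numFieldNormedType.Exports.

Local Open Scope classical_set_scope.
Local Open Scope ring_scope.

Definition log2 (R : realType) (x : R) : R := ln x / ln 2.

Section Plane.
Variable R : realType.
Implicit Types (p q r u : R * R) (A : set (R * R)) (s : seq (R * R)).

Definition dotp p q : R := p.1 * q.1 + p.2 * q.2.

(* The lines of the plane are the sets [{x | dotp x u = c}] with [u != 0]. *)
Definition collinear p q r : Prop :=
  exists2 u, u != 0 & exists c : R, [/\ dotp p u = c, dotp q u = c & dotp r u = c].

Definition general_position A : Prop :=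
  forall p q r, A p -> A q -> A r -> p != q -> p != r -> q != r ->
  ~ collinear p q r.

(* [geom_edge A p q]: the segment [pq] is an edge of the complete geometric
   graph on [A]; segments are given by their two (unordered) endpoints. *)
Definition geom_edge A p q : Prop := [/\ A p, A q & p != q].

(* As any two distinct vertices are adjacent, a path of the complete geometric
   graph on [A] is just a nonempty sequence of distinct vertices. *)
Definition geom_path A s : Prop :=
  [/\ s != [::], uniq s & {in s, forall p, A p}].

Definition monotone_in u s : bool :=
  sorted (fun p q => 0 < dotp (q - p) u) s.

Definition monotone s : Prop := exists2 u, u != 0 & monotone_in u s.

Definition path_edge s p q : bool := infix [:: p; q] s || infix [:: q; p] s.

Definition covers_edges A (F : seq (seq (R * R))) : Prop :=
  forall p q, geom_edge A p q -> exists2 s, s \in F & path_edge s p q.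

Definition monotone_coverable A (k : R) : Prop :=
  exists F : seq (seq (R * R)),
    [/\ {in F, forall s, geom_path A s /\ monotone s},
        covers_edges A F & (size F)%:R <= k].

Definition unit_square : set (R * R) := `[0, 1] `*` `[0, 1].

End Plane.

Section Random.
Variable R : realType.

Definition mutually_independent d d' (T : measurableType d)
    (T' : measurableType d') (P : probability T R) (I : finType)
    (X : I -> {RV P >-> T'}) : Prop :=
  forall (J : {set I}) (B : I -> set T'),
    (forall i, measurable (B i)) ->
    P (\bigcap_(i in [set` J]) (X i @^-1` B i)) =
    (\prod_(i in J) P (X i @^-1` B i))%E.

(* The unit square has area 1, so no normalisation is needed. *)
Definition uniform_on_square d (T : measurableType d) (P : probability T R)
    (X : {RV P >-> (R * R)%type}) : Prop :=
  forall B : set (R * R), measurable B ->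
    distribution P X B =
    (lebesgue_measure \x lebesgue_measure)%E (B `&` @unit_square R).

End Random.

(* Main.v *)
Require Import Defs.
From HB Require Import structures.
From mathcomp Require Import all_boot all_order all_algebra.
From mathcomp Require Import all_classical all_reals all_analysis.
From mathcomp Require Import measurable_realfun finmap ring lra zify.

Set Implicit Arguments.
Unset Strict Implicit.
Unset Printing Implicit Defensive.

Import Order.TTheory GRing.Theory Num.Theory.
Import numFieldNormedType.Exports.

Local Open Scope classical_set_scope.
Local Open Scope ring_scope.

(** Fix a resolution [N] and the [O(N)] directions [(1, t)] and [(t, 1)], where
[t] runs through a grid of mesh [1/N] covering [-1, 1]. In each direction, cut
the unit square into [O(N)] strips of width [2/N], consecutive strips
overlapping by one half. Every line that meets the square is almost orthogonal
to one of the directions, so that its part in the square lies in a single strip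
([line_in_strip]). This elementary fact is used at two resolutions.

At resolution [N = n / log n] a strip contains [2 log n] points on average, and
with high probability no strip contains [m = 16 log n] points or more. The two
ends of any edge lie in a common strip of a direction that is not orthogonal to
the edge. For a direction, number the points in each strip; for two numbers
[c, d < m] and a parity [r], visit the strips of parity [r] in their order and
use in each the edge from the point number [c] to the point number [d], if that
edge goes forward. Strips of the same parity are disjoint and ordered along the
direction, so this is a monotone path. These paths cover all edges
([sparse_coverable]), and there are [O(N m^2) = O(n log n)] of them.

At resolution [n^4] with high probability no strip contains three points.
Then no line contains three of the points; nor do two of them coincide, since
these two and a third one would lie on a line ([sparse3_general_position]).

Both probabilities come from one union bound over the [32 N^2] strips and the
[m]-element sets of indices ([crowded_strip_le]). A given set of [m] points lies
in a given strip with probability at most [(2/N)^m] by independence, since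
the area of the strip in the square is at most [2/N]; so the probability that
some strip contains [m] points is at most [32 N^2 C(n, m) (2/N)^m], which is
[O(1/n)] in both cases.

The event is measurable because a covering family is encoded by a finite family
of index sequences, of which there are countably many, and because the direction
of a monotone path can be taken rational: the set of directions in which a path
is monotone is open ([measurable_good]). *)

(** * Lines and strips *)

Section Strips.
Variable R : realType.
Implicit Types (p q u v w : R * R) (N : nat).

(** For [k < 4 * N] the slopes [slope N k] form a grid of mesh [1/N] that
contains [-1, 1] with some room above [1], which is needed because a slope
strictly above a given one is chosen. *)
Definition slope N (k : nat) : R := k%:R / N%:R - 1.

Definition grid_dir N (b : bool) (k : nat) : R * R :=
  if b then (1, slope N k) else (slope N k, 1).

(** Strip number [a] consists of the cells [a] and [a.+1], of width [1/N] each,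
so that every set whose heights [dotp p u] lie in an interval of length at most
[1/N] is contained in one strip. The shift by [1] makes the numbers natural: on
the unit square the heights are at least [-1]. *)
Definition strip N (b : bool) (k a : nat) : set (R * R) :=
  [set p | a%:R <= N%:R * (dotp p (grid_dir N b k) + 1) < a.+2%:R].

Lemma dotpBl p q u : dotp (q - p) u = dotp q u - dotp p u.
Proof. by rewrite /dotp /=; ring. Qed.

(** The line [x * w1 + y * w2 = const] has the equation [x + y * t0 = c] with
[t0 = w2 / w1] in [-1, 1]. The least grid slope [t] with [t0 < t] satisfies
[t <= t0 + 1/N], hence [x + y * t = c + y * (t - t0)] stays within [1/N] of [c]
as [y] runs through [0, 1]. As [t != t0], the only vector killed by both forms
is zero. *)
Lemma line_near_grid N (x0 y0 w1 w2 : R) :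
  (0 < N)%N -> `|w2| <= `|w1| -> w1 != 0 ->
  0 <= x0 <= 1 -> 0 <= y0 <= 1 ->
  exists k a : nat, [/\ (k < 4 * N)%N, (a < 4 * N)%N,
    (forall x y, 0 <= y <= 1 -> x * w1 + y * w2 = x0 * w1 + y0 * w2 ->
       a%:R <= N%:R * (x + y * slope N k + 1) < a.+2%:R) &
    (forall x y, x * w1 + y * w2 = 0 -> x + y * slope N k = 0 ->
       x = 0 /\ y = 0)].
Proof.
move=> N0 w21 w10 /andP[x00 x01] /andP[y00 y01].
have NR : (0 : R) < N%:R by rewrite ltr0n.
pose t0 := w2 / w1.
have t0E : w2 = t0 * w1 by rewrite /t0 divfK.
have : `|t0| <= 1 by rewrite normrM normfV ler_pdivrMr ?mul1r// normr_gt0.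
rewrite ler_norml => /andP[t0l t0u].
move: t0 t0E t0l t0u => t0 t0E t0l t0u.
have e0 : 0 <= N%:R * (t0 + 1) :> R by apply: mulr_ge0; lra.
have /andP[k1 k2] := truncn_itv e0; set k := Num.truncn _ in k1 k2.
clearbody k.
pose c := x0 + y0 * t0.
have c0 : 0 <= N%:R * (c + 1) :> R by apply: mulr_ge0; rewrite /c; nra.
have /andP[a1 a2] := truncn_itv c0; set a := Num.truncn _ in a1 a2.
clearbody a.
have kR : (k%:R : R) <= 2 * N%:R.
  by apply: (le_trans k1); rewrite mulrC ler_wpM2r ?(ltW NR)//; lra.
have aR : (a%:R : R) <= 3 * N%:R.
  by apply: (le_trans a1); rewrite mulrC ler_wpM2r ?(ltW NR)// /c; nra.
have kN : (k <= 2 * N)%N by rewrite -(ler_nat R) natrM.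
have aN : (a <= 3 * N)%N by rewrite -(ler_nat R) natrM.
have sE : N%:R * slope N k.+1 = k.+1%:R - N%:R :> R.
  by rewrite /slope mulrBr mulr1 mulrCA divff ?mulr1// gt_eqF.
exists k.+1, a; split.
- by clear -kN N0; lia.
- by clear -aN N0; lia.
- move=> x y /andP[y0' y1'] E.
  have {}E : x + y * t0 = c.
    by apply: (mulIf w10); rewrite /c; move: E; rewrite t0E; lra.
  have -> : N%:R * (x + y * slope N k.+1 + 1) =
     N%:R * (c + 1) + y * (N%:R * slope N k.+1 + N%:R - N%:R * (t0 + 1)) :> R.
    by rewrite -E; ring.
  rewrite sE subrK; move: k2; set K := k.+1%:R => k2.
  have kK : K = k%:R + 1 :> R by rewrite /K -natr1.
  have -> : a.+2%:R = a%:R + 1 + 1 :> R by rewrite !natr1.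
  rewrite -[a.+1%:R]natr1 in a2.
  have d0 : 0 <= K - N%:R * (t0 + 1) <= 1 by lra.
  have /andP[d1 d2] : 0 <= y * (K - N%:R * (t0 + 1)) <= 1.
    case/andP: d0 => d0 d1; rewrite mulr_ge0//=.
    by rewrite -[leRHS]mulr1 ler_pM.
  by apply/andP; split; lra.
- move=> x y E F.
  have {}E : x + y * t0 = 0.
    by apply: (mulIf w10); move: E; rewrite t0E mul0r; lra.
  have y_0 : y * (k.+1%:R - N%:R * (t0 + 1)) = 0.
    have -> : k.+1%:R = N%:R * slope N k.+1 + N%:R :> R by rewrite sE subrK.
    have -> : y * (N%:R * slope N k.+1 + N%:R - N%:R * (t0 + 1)) =
      N%:R * ((x + y * slope N k.+1) - (x + y * t0)) by ring.
    by rewrite E F subrr mulr0.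
  have y0' : y = 0.
    by move/eqP: y_0; rewrite mulf_eq0 [_ - _ == 0]gt_eqF ?orbF ?subr_gt0 // =>
      /eqP.
  by split => //; move: E; rewrite y0' mul0r addr0.
Qed.

Lemma unit_squareP p : unit_square p <-> 0 <= p.1 <= 1 /\ 0 <= p.2 <= 1.
Proof. by rewrite /unit_square /= !in_itv. Qed.

(** The grid directions [(1, t)] serve the lines whose normal vector has the
larger first coordinate, and the directions [(t, 1)] serve the others. *)
Lemma line_in_strip N p0 w : (0 < N)%N -> w != 0 -> unit_square p0 ->
  exists (b : bool) (k a : 'I_(4 * N)),
    (forall p, unit_square p -> dotp p w = dotp p0 w -> strip N b k a p) /\
    (forall v, v != 0 -> dotp v w = 0 -> dotp v (grid_dir N b k) != 0).
Proof.
case: p0 w => [x0 y0] [w1 w2] N0 w0 /unit_squareP[/= hx hy].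
have w00 : w1 != 0 \/ w2 != 0.
  by apply/orP; rewrite -negb_and; apply: contra w0 => /andP[/eqP-> /eqP->].
have [w21|w12] := leP `|w2| `|w1|.
- have w10 : w1 != 0.
    apply: contraTneq w21 => w10; rewrite w10 normr0 normr_le0.
    by case: w00 => //; rewrite w10 eqxx.
  have [k [a [kN aN H1 H2]]] := line_near_grid N0 w21 w10 hx hy.
  exists true, (Ordinal kN), (Ordinal aN); split => /=.
  + move=> [x y] /unit_squareP[/= hx' hy'] E; rewrite /strip /dotp /= mulr1.
    exact: H1.
  + move=> [x y] xy0 E; rewrite /dotp /= mulr1; apply: contra_neq xy0 => F.
    by have [-> ->] := H2 x y E F.
- have w20 : w2 != 0.
    by apply: contraTneq w12 => ->; rewrite normr0 -leNgt.
  have [k [a [kN aN H1 H2]]] := line_near_grid N0 (ltW w12) w20 hy hx.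
  exists false, (Ordinal kN), (Ordinal aN); split => /=.
  + move=> [x y] /unit_squareP[/= hx' hy'] E; rewrite /strip /dotp /= mulr1.
    rewrite [x * _ + y]addrC; apply: H1 => //.
    by move: E; rewrite /dotp /= addrC => ->; rewrite addrC.
  + move=> [x y] xy0 E; rewrite /dotp /= mulr1; apply: contra_neq xy0 => F.
    by have [-> ->] := H2 y x (etrans (addrC _ _) E) (etrans (addrC _ _) F).
Qed.
End Strips.

(** * Covering by monotone paths *)

Lemma infix_map (T U : eqType) (f : T -> U) (s t : seq T) :
  infix s t -> infix (map f s) (map f t).
Proof.
move=> /infixP[l [r ->]]; rewrite !map_cat; apply/infixP.
by exists (map f l), (map f r).
Qed.

Lemma infix_pmap (T U : eqType) (f : T -> option U) (s t : seq T) :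
  infix s t -> infix (pmap f s) (pmap f t).
Proof.
move=> /infixP[l [r ->]]; rewrite !pmap_cat; apply/infixP.
by exists (pmap f l), (pmap f r).
Qed.

Lemma pairwise_flatten_iota (T : eqType) (r : rel T) (B : nat -> seq T) e0 l :
  (forall e, pairwise r (B e)) ->
  (forall e e' i j, (e < e')%N -> i \in B e -> j \in B e' -> r i j) ->
  pairwise r (flatten (map B (iota e0 l))).
Proof.
move=> rB rBB; elim: l e0 => //= l IH e0; rewrite pairwise_cat rB IH !andbT.
apply/allrelP => i j iB /flatten_mapP[e]; rewrite mem_iota => /andP[e0e _] jB.
exact: rBB iB jB.
Qed.

Section IndexFamilies.
Variables (R : realType) (n : nat).
Implicit Types (x : 'I_n -> R * R) (F : seq (seq 'I_n)) (s t : seq 'I_n).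

(** The conditions on a covering family that do not involve the positions of the
vertices. *)
Definition index_cover F : Prop :=
  {in F, forall s, s != [::] /\ uniq s} /\
  forall i j : 'I_n, i != j ->
    exists2 s, s \in F & infix [:: i; j] s || infix [:: j; i] s.

(** For distinct vertices, paths of points and paths of indices correspond to
each other; [h] below is the partial inverse of [x]. *)
Lemma coverable_index x (k : R) : injective x ->
  monotone_coverable (range x) k <->
  exists F, [/\ index_cover F, {in F, forall s, Defs.monotone (map x s)} &
                (size F)%:R <= k].
Proof.
move=> x_inj; split.
- case=> F [FP Fcov Fk].
  pose h p := [pick i | x i == p].
  have hx : pcancel x h.
    move=> i; rewrite /h; case: pickP => [j /eqP/x_inj->//|/(_ i)].
    by rewrite eqxx.
  have xh (s : seq (R * R)) : {in s, forall p, range x p} ->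
      map x (pmap h s) = s.
    elim: s => //= p s IH ps.
    have [i _ <-] := ps p (mem_head _ _).
    by rewrite hx /= IH// => q qs; apply: ps; rewrite inE qs orbT.
  exists (map (pmap h) F); split; last by rewrite size_map.
    split.
      move=> _ /mapP[s sF ->]; have [[s0 su sx] _] := FP s sF.
      split; last by rewrite -(map_inj_uniq x_inj) xh.
      by apply: contra s0 => /eqP e; rewrite -(xh s)// e.
    move=> i j ij; have := Fcov (x i) (x j).
    case; first by split; [exists i|exists j|rewrite (inj_eq x_inj)].
    move=> s sF spq; exists (pmap h s); first exact: map_f.
    by case/orP: spq => /(infix_pmap h); rewrite /= !hx /= => ->; rewrite ?orbT.
  move=> _ /mapP[s sF ->]; have [[s0 su sx] sm] := FP s sF.
  by rewrite xh.
- case=> F [[FP Fcov] Fm Fk]; exists (map (map x) F); split;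
    last by rewrite size_map.
    move=> _ /mapP[s sF ->]; split; last exact: Fm.
    have [s0 su] := FP s sF; split; last by move=> _ /mapP[i _ ->]; exists i.
    + by move: s0; apply: contra; case: (s).
    + by rewrite map_inj_uniq.
  move=> _ _ [[i _ <-] [j _ <-]]; rewrite (inj_eq x_inj) => /Fcov[s sF sij].
  exists (map x s); first exact: map_f.
  by case/orP: sij => /(infix_map x) /= h; rewrite /path_edge h ?orbT.
Qed.
End IndexFamilies.

Section Cover.
Variables (R : realType) (n : nat) (x : 'I_n -> R * R) (N m : nat).

Definition strip_members (b : bool) (k a : nat) : {set 'I_n} :=
  [set i | `[< strip N b k a (x i) >]].

Lemma strip_membersP b k a i :
  reflect (strip N b k a (x i)) (i \in strip_members b k a).
Proof. by rewrite inE; exact: asboolP. Qed.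

Definition sparse_strips : Prop :=
  forall (b : bool) (k a : 'I_(4 * N)), (#|strip_members b k a| < m)%N.

Definition height (b : bool) (k : nat) (i : 'I_n) : R :=
  dotp (x i) (grid_dir R N b k).

(** The edge from member number [c] to member number [d] of [s], provided that
it goes forward. *)
Definition link (f : 'I_n -> R) (s : seq 'I_n) (c d : nat) : seq 'I_n :=
  if (onth s c, onth s d) is (Some i, Some j) then
    if f i < f j then [:: i; j] else [::]
  else [::].

(** The path that visits the strips numbered [r], [r + 2], [r + 4], ... in this
order and uses one edge in each of them. *)
Definition zigzag (b : bool) (k r c d : nat) : seq 'I_n :=
  flatten [seq link (height b k) (enum (strip_members b k (r + 2 * e))) c d
          | e <- iota 0 (2 * N)].

Lemma link_sub f s c d : {subset link f s c d <= s}.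
Proof.
rewrite /link => i.
case Ec: (onth s c) => [p|]//; case Ed: (onth s d) => [q|]//.
case: ifP => // _; rewrite !inE => /orP[]/eqP->; apply/onthP.
  by exists c.
by exists d.
Qed.

Lemma pairwise_link f s c d : pairwise (fun i j => f i < f j) (link f s c d).
Proof.
rewrite /link; case: (onth s c) => [i|]//; case: (onth s d) => [j|]//.
by case: ifP => //= ->.
Qed.

(** Two strips whose numbers differ by at least two share no cell. *)
Lemma height_lt b k a a' i j : (0 < N)%N -> (a.+2 <= a')%N ->
  i \in strip_members b k a -> j \in strip_members b k a' ->
  height b k i < height b k j.
Proof.
move=> N0 aa' /strip_membersP; rewrite /strip /= => /andP[_ ia].
move=> /strip_membersP; rewrite /strip /= => /andP[ja _].
have := lt_le_trans (lt_le_trans ia _) ja; rewrite ler_nat => /(_ aa').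
by rewrite ltr_pM2l ?ltr0n// ltrD2r.
Qed.

Lemma zigzag_increasing b k r c d : (0 < N)%N ->
  pairwise (fun i j => height b k i < height b k j) (zigzag b k r c d).
Proof.
move=> N0; apply: pairwise_flatten_iota => [e|e e' i j ee'].
  exact: pairwise_link.
move=> /link_sub; rewrite mem_enum => ie /link_sub; rewrite mem_enum => je.
by apply: height_lt ie je => //; lia.
Qed.

Lemma zigzag_uniq b k r c d : (0 < N)%N -> uniq (zigzag b k r c d).
Proof.
move=> N0; apply: (@sorted_uniq _ (fun i j => height b k i < height b k j)).
- by move=> j i l; apply: lt_trans.
- by move=> i; rewrite ltxx.
- exact/pairwise_sorted/zigzag_increasing.
Qed.

Lemma zigzag_monotone b k r c d : (0 < N)%N ->
  Defs.monotone (map x (zigzag b k r c d)).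
Proof.
move=> N0; exists (grid_dir R N b k).
  by rewrite /grid_dir; case: b; rewrite -pair_eqE /pair_eq /= oner_eq0 ?andbF.
rewrite /monotone_in sorted_map.
have := pairwise_sorted (zigzag_increasing b k r c d N0).
by apply: sub_sorted => i j; rewrite /= dotpBl subr_gt0.
Qed.

Lemma zigzag_edge (b : bool) (k a : 'I_(4 * N)) i j : sparse_strips ->
  i \in strip_members b k a -> j \in strip_members b k a ->
  height b k i < height b k j ->
  exists r : 'I_2, exists c d : 'I_m, infix [:: i; j] (zigzag b k r c d).
Proof.
move=> sp ia ja ij; set s := enum (strip_members b k a).
have rank l : l \in strip_members b k a ->
    exists c : 'I_m, onth s c = Some l.
  rewrite -mem_enum => /onthP[c ce].
  have cm : (c < m)%N.
    by apply: (leq_ltn_trans _ (sp b k a)); rewrite cardE ltnW// -onthTE ce.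
  by exists (Ordinal cm).
have [c ci] := rank i ia; have [d dj] := rank j ja.
have a2 : (a %% 2 < 2)%N by rewrite ltn_mod.
exists (Ordinal a2), c, d; rewrite /zigzag /=.
have : (a %/ 2)%N \in iota 0 (2 * N).
  by rewrite mem_iota /= add0n ltn_divLR// (leq_trans (ltn_ord a))//; lia.
move=> /splitPr[l r]; rewrite map_cat flatten_cat /=.
have -> : (a %% 2 + 2 * (a %/ 2) = a)%N.
  by rewrite addnC [(2 * _)%N]mulnC -divn_eq.
rewrite -/s {2}/link ci dj ij; apply/infixP.
by do 2!eexists; reflexivity.
Qed.

(** Two distinct points lie in a common strip by [line_in_strip], applied to the
line through them, and the direction of this strip is not orthogonal to the
edge, so that one of its two orientations goes forward. The number of zigzags is
[2 * (4 * N) * 2 * m * m]. *)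
Lemma sparse_coverable : (0 < N)%N -> injective x ->
  (forall i, unit_square (x i)) -> sparse_strips ->
  monotone_coverable (range x) (16 * N * m ^ 2)%:R.
Proof.
move=> N0 x_inj xS sp; apply/(coverable_index _ x_inj).
pose I := (bool * 'I_(4 * N) * 'I_2 * 'I_m * 'I_m)%type.
pose path (z : I) := let: (b, k, r, c, d) := z in zigzag b k r c d.
exists [seq s <- [seq path z | z : I] | s != [::]]; split.
- split.
    move=> s; rewrite mem_filter => /andP[s0].
    case/fintype.imageP=> [[[[[b k] r] c] d] _ sE].
    by split => //; rewrite sE; exact: zigzag_uniq.
  suff cov i j b (k a : 'I_(4 * N)) : i \in strip_members b k a ->
      j \in strip_members b k a -> height b k i < height b k j ->
      exists2 s, s \in [seq s <- [seq path z | z : I] | s != [::]]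
        & infix [:: i; j] s.
    move=> i j ij.
    have v0 : x j - x i != 0 by rewrite subr_eq0 eq_sym (inj_eq x_inj).
    pose v := x j - x i; pose w : R * R := (- v.2, v.1).
    have w0 : w != 0.
      apply: contra v0; rewrite -!pair_eqE /pair_eq /= oppr_eq0 => /andP[v2 v1].
      by apply/andP; split.
    have vw : dotp v w = 0 by rewrite /dotp /=; ring.
    have [b [k [a [H1 H2]]]] := line_in_strip N0 w0 (xS i).
    have ia : i \in strip_members b k a by apply/strip_membersP/H1.
    have ja : j \in strip_members b k a.
      apply/strip_membersP/H1 => //; apply/eqP.
      by rewrite -subr_eq0 -dotpBl -/v vw.
    have := H2 _ v0 vw; rewrite dotpBl subr_eq0 neq_lt => /orP[] h.
      have [s sF ss] := cov _ _ _ _ _ ja ia h.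
      by exists s => //; rewrite ss orbT.
    by have [s sF ss] := cov _ _ _ _ _ ia ja h; exists s => //; rewrite ss.
  move=> ia ja h; have [r [c [d zE]]] := zigzag_edge sp ia ja h.
  exists (zigzag b k r c d) => //; rewrite mem_filter; apply/andP; split.
    by apply: contraTneq zE => ->.
  by apply/fintype.imageP; exists (b, k, r, c, d).
- move=> s; rewrite mem_filter => /andP[_].
  case/fintype.imageP=> [[[[[b k] r] c] d] _ ->].
  exact: zigzag_monotone.
- rewrite ler_nat size_filter (leq_trans (count_size _ _))//.
  rewrite size_map -cardE !card_prod card_bool !card_ord; lia.
Qed.

End Cover.

(** Three collinear points would lie in one strip, by [line_in_strip]. If two
indices had the same point, then these two indices and any third one would be a
collinear triple. *)
Lemma sparse3_general_position (R : realType) n (x : 'I_n -> R * R) N :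
  (2 < n)%N -> (0 < N)%N -> (forall i, unit_square (x i)) ->
  sparse_strips x N 3 -> injective x /\ general_position (range x).
Proof.
move=> n2 N0 xS sp.
have no3 (i j l : 'I_n) : uniq [:: i; j; l] -> ~ collinear (x i) (x j) (x l).
  move=> u3 [w w0 [c [iw jw lw]]].
  have [b [k [a [H1 _]]]] := line_in_strip N0 w0 (xS i).
  have := sp b k a; apply/negP; rewrite -leqNgt.
  have c3 : #|[set:: [:: i; j; l]]| = 3%N by rewrite cardsE; apply/card_uniqP.
  apply: (@leq_trans #|[set:: [:: i; j; l]]|); first by rewrite c3.
  apply/subset_leq_card/fintype.subsetP => z zs; apply/strip_membersP.
  by move: zs; rewrite !inE => /or3P[] /eqP ->; apply: H1 => //; congruence.
split.
- move=> i j ij; apply/eqP/negPn/negP => nij.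
  have [l /negP li /negP lj] : exists2 l, l != i & l != j.
    have : (0 < #|~: [set i; j]|)%N.
      by rewrite cardsCs finset.setCK cards2 card_ord; case: (i != j); lia.
    by case/card_gt0P => l; rewrite !inE negb_or => /andP[]; exists l.
  apply: (no3 i j l).
    rewrite /= !inE negb_or nij (eq_sym i l) (eq_sym j l) !andbT /=.
    by apply/andP; split; apply/negP.
  have [e|e] := eqVneq (x i) (x l).
    exists (1, 0); first by rewrite -pair_eqE /pair_eq /= oner_eq0.
    by exists (x i).1; rewrite /dotp -ij -e /=; split; ring.
  pose v := x l - x i; exists (- v.2, v.1).
    move: e; rewrite eq_sym -subr_eq0; apply: contra.
    by rewrite -!pair_eqE /pair_eq /= oppr_eq0 andbC.
  exists (dotp (x i) (- v.2, v.1)); rewrite -ij; split => //.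
  by rewrite /dotp /v /=; ring.
- move=> _ _ _ [i _ <-] [j _ <-] [l _ <-] ij il jl; apply: no3.
  have neq (z t : 'I_n) : x z != x t -> z != t by apply: contra => /eqP->.
  by rewrite /= !inE negb_or !neq.
Qed.

(** * Measurability *)

Section Measurability.
Variable R : realType.

(** If the range has [n] elements, then listing all values of [x] produces a
list of length [n] that contains [n] different elements, hence has no
repetition. *)
Lemma card_range_injective (U : choiceType) n (x : 'I_n -> U) :
  (range x #= `I_n)%card <-> injective x.
Proof.
split=> [xn|x_inj]; last first.
  have h : (range x #= [set: 'I_n])%card.
    by apply: inj_card_eq => ? ? _ _; exact: x_inj.
  by rewrite (card_eq_trans h) // card_eq_sym card_II.
apply/injectiveP; rewrite /injectiveb /dinjectiveb.
have fr : finite_set (range x) by apply/finite_setP; exists n.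
apply: (@leq_size_uniq _ (fset_set (range x))); first exact: fset_uniq.
  move=> p; rewrite in_fset_set// => /set_mem[i _ <-]; apply: map_f.
  by rewrite mem_enum.
by rewrite size_map -cardE card_ord -[in leqLHS](card_fset_set xn).
Qed.

Lemma near_dotp_gt0 (z u : R * R) :
  0 < dotp z u -> \forall v \near u, 0 < dotp z v.
Proof.
move=> h; suff cz : dotp z v @[v --> u] --> dotp z u.
  exact: (cvgr_gt _ cz _ h).
apply: cvgD; (apply: cvgM; first exact: cvg_cst).
- exact: cvg_fst.
- exact: cvg_snd.
Qed.

Lemma near_monotone_in (s : seq (R * R)) (u : R * R) :
  monotone_in u s -> \forall v \near u, monotone_in v s.
Proof.
rewrite /monotone_in; case: s => [|p s] /=; first by move=> _; exact: filterE.
elim: s p => [|q s IH] p /=; first by move=> _; exact: filterE.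
move=> /andP[/near_dotp_gt0 h1 /IH h2]; near=> v.
by apply/andP; split; near: v.
Unshelve. all: by end_near. Qed.

(** The directions in which a path is monotone form an open set, which contains
a rational point if it is nonempty. This turns an uncountable union of events
into a countable one. *)
Lemma monotone_rat (s : seq (R * R)) :
  Defs.monotone s <->
  exists ab : rat * rat,
    let u : R * R := (ratr ab.1, ratr ab.2) in u != 0 /\ monotone_in u s.
Proof.
split=> [[u u0 us]|[ab [u0 us]]]; last by exists (ratr ab.1, ratr ab.2).
case: s us => [_|p [_|q s us]].
- by exists (1, 0); rewrite /= rmorph1 rmorph0 -pair_eqE /pair_eq /= oner_eq0.
- by exists (1, 0); rewrite /= rmorph1 rmorph0 -pair_eqE /pair_eq /= oner_eq0.
have [[A B] /= [nA nB] AB] := near_monotone_in us.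
have rat_in (r : R) (S : set R) : nbhs r S -> exists a : rat, S (ratr a).
  move=> rS.
  have [|t [St [a _ aE]]] := @dense_rat R S^° _ (@open_interior _ S).
    by exists r.
  by exists a; apply: interior_subset; rewrite aE.
have [a Aa] := rat_in _ _ nA; have [b Bb] := rat_in _ _ nB.
have h : monotone_in (ratr a, ratr b) [:: p, q & s].
  by apply: (AB (ratr a, ratr b)).
exists (a, b); split => //=; apply: contraTneq h => ->.
by rewrite /monotone_in /= /dotp /= !mulr0 addr0 ltxx.
Qed.

(** Twice the signed area of the triangle [p q r]. *)
Definition orient (p q r : R * R) : R :=
  (q.1 - p.1) * (r.2 - p.2) - (q.2 - p.2) * (r.1 - p.1).

Lemma collinear_orient (p q r : R * R) :
  p != q -> collinear p q r <-> orient p q r == 0.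
Proof.
move=> pq; split.
  move=> [u u0 [c [pc qc rc]]].
  have h1 : (q.1 - p.1) * u.1 + (q.2 - p.2) * u.2 = 0.
    by move: pc qc; rewrite /dotp; lra.
  have h2 : (r.1 - p.1) * u.1 + (r.2 - p.2) * u.2 = 0.
    by move: pc rc; rewrite /dotp; lra.
  have [u1|u1] := eqVneq u.1 0.
    have u2 : u.2 != 0.
      by apply: contra u0 => /eqP u2; rewrite -pair_eqE /pair_eq /= u1 u2 eqxx.
    apply/eqP/(mulIf u2); rewrite mul0r /orient.
    transitivity ((q.1 - p.1) * ((r.1 - p.1) * u.1 + (r.2 - p.2) * u.2) -
      (r.1 - p.1) * ((q.1 - p.1) * u.1 + (q.2 - p.2) * u.2)); first by ring.
    by rewrite h1 h2; ring.
  apply/eqP/(mulIf u1); rewrite mul0r /orient.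
  transitivity ((r.2 - p.2) * ((q.1 - p.1) * u.1 + (q.2 - p.2) * u.2) -
    (q.2 - p.2) * ((r.1 - p.1) * u.1 + (r.2 - p.2) * u.2)); first by ring.
  by rewrite h1 h2; ring.
move=> /eqP o0; exists (- (q.2 - p.2), q.1 - p.1).
  apply: contra pq; rewrite -!pair_eqE /pair_eq /= oppr_eq0 !subr_eq0.
  by rewrite ![q.1 == _]eq_sym ![q.2 == _]eq_sym andbC.
exists (dotp p (- (q.2 - p.2), q.1 - p.1)); split => //.
  by rewrite /dotp /=; ring.
by apply/eqP; rewrite -subr_eq0 -o0 /dotp /orient /=; apply/eqP; ring.
Qed.

(** For distinct vertices, general position is a finite conjunction of
polynomial inequations, so that it defines a measurable event. *)
Lemma general_position_orient n (x : 'I_n -> R * R) : injective x ->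
  general_position (range x) <->
  forall t : 'I_n * 'I_n * 'I_n, uniq [:: t.1.1; t.1.2; t.2] ->
    orient (x t.1.1) (x t.1.2) (x t.2) != 0.
Proof.
move=> x_inj; split=> [gp [[i j] l] /=|gp].
  rewrite !inE negb_or andbT => /andP[/andP[ij il] jl].
  have xij : x i != x j by rewrite (inj_eq x_inj).
  apply/negP => /(collinear_orient _ xij); apply: gp;
    rewrite ?(inj_eq x_inj)//; by [exists i|exists j|exists l].
move=> _ _ _ [i _ <-] [j _ <-] [l _ <-] ij il jl /(collinear_orient _ ij).
apply/negP/(gp (i, j, l)); rewrite /= !inE negb_or.
by move: ij il jl; rewrite !(inj_eq x_inj) => -> -> ->.
Qed.

Section Events.
Variables (d : measure_display) (T : measurableType d).

Lemma measurable_gt0 (f : T -> R) : measurable_fun setT f ->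
  measurable [set w | 0 < f w].
Proof.
move=> mf; rewrite -[X in measurable X]setTI.
have -> : [set w | 0 < f w] = f @^-1` `]0, +oo[.
  by apply/seteqP; split => w /=; rewrite in_itv/= andbT.
by apply: mf => //; exact: measurable_itv.
Qed.

Lemma measurable_neq0 (f : T -> R) : measurable_fun setT f ->
  measurable [set w | f w != 0].
Proof.
move=> mf.
have -> : [set w | f w != 0] = [set w | 0 < f w] `|` [set w | 0 < - f w].
  apply/seteqP; split => w /=; rewrite oppr_gt0 neq_lt.
    by case/orP; [right|left].
  by case=> ->; rewrite ?orbT.
apply: measurableU; apply: measurable_gt0 => //; exact: measurableT_comp.
Qed.

Lemma measurable_bool_and (b : bool) (A : set T) :
  measurable A -> measurable [set w | b /\ A w].
Proof.
move=> mA; case: b.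
  by rewrite [X in measurable X](_ : _ = A)//; apply/seteqP; split=> w //= [].
by rewrite [X in measurable X](_ : _ = set0)//; apply/seteqP; split=> w //= [].
Qed.

Lemma measurable_forall_fin (I : finType) (b : I -> bool) (A : I -> set T) :
  (forall i, measurable (A i)) -> measurable [set w | forall i, b i -> A i w].
Proof.
move=> mA.
rewrite [X in measurable X](_ : _ = \bigcap_(i in [set i | b i]) A i).
  by apply: fin_bigcap_measurable.
by apply/seteqP; split=> w /= h i; apply: h.
Qed.

End Events.

Section Vertices.
Variables (d : measure_display) (T : measurableType d) (n : nat).
Variable X : 'I_n -> T -> R * R.
Hypothesis mX : forall i, measurable_fun setT (X i).

Lemma measurable_coord1 i : measurable_fun setT (fun w => (X i w).1).
Proof. by apply: (measurableT_comp measurable_fst). Qed.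

Lemma measurable_coord2 i : measurable_fun setT (fun w => (X i w).2).
Proof. by apply: (measurableT_comp measurable_snd). Qed.

Lemma measurable_monotone_in (u : R * R) (s : seq 'I_n) :
  measurable [set w | monotone_in u (map (fun i => X i w) s)].
Proof.
have mT : measurable [set _ : T | true].
  by rewrite [X in measurable X](_ : _ = setT)//; apply/seteqP; split.
rewrite /monotone_in; case: s => [|i s] //=.
elim: s i => [|j s IH] i //=.
rewrite [X in measurable X](_ : _ = [set w | 0 < dotp (X j w - X i w) u] `&`
  [set w | path (fun p q => 0 < dotp (q - p) u) (X j w)
             (map (fun i => X i w) s)]);
  last by apply/seteqP; split=> w /= /andP.
apply: measurableI => //; apply: measurable_gt0.
by apply: measurable_funD; apply: measurable_funM => //; apply: measurable_funB;
  [exact: measurable_coord1 | exact: measurable_coord1|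
   exact: measurable_coord2 | exact: measurable_coord2].
Qed.

Lemma measurable_monotone (s : seq 'I_n) :
  measurable [set w | Defs.monotone (map (fun i => X i w) s)].
Proof.
rewrite [X in measurable X](_ : _ = \bigcup_(ab : rat * rat)
   [set w | ((ratr ab.1, ratr ab.2) != 0 :> R * R) /\
     [set w | monotone_in (ratr ab.1, ratr ab.2) (map (fun i => X i w) s)] w]).
  apply: countable_bigcupT_measurable; first exact: countableP.
  by move=> ab; apply: measurable_bool_and; exact: measurable_monotone_in.
apply/seteqP; split=> w /=.
  by move=> /monotone_rat[ab [u0 us]]; exists ab.
by move=> [ab _ [u0 us]]; apply/monotone_rat; exists ab.
Qed.

(** The families of index sequences are countably many, and for a fixed family
only the monotonicity of its paths is random. *)
Lemma measurable_good (k : R) :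
  measurable [set w | let A := range (fun i : 'I_n => X i w) in
    [/\ (A #= `I_n)%card, general_position A & monotone_coverable A k]].
Proof.
pose Inj := [set w | forall t : 'I_n * 'I_n, t.1 != t.2 ->
  [set w | X t.1 w != X t.2 w] w].
pose GP := [set w | forall t : 'I_n * 'I_n * 'I_n,
  uniq [:: t.1.1; t.1.2; t.2] ->
  [set w | orient (X t.1.1 w) (X t.1.2 w) (X t.2 w) != 0] w].
pose Cov := \bigcup_(F : seq (seq 'I_n))
  [set w | `[< index_cover F /\ (size F)%:R <= k >] /\
     (\bigcap_(s in [set` F])
        [set w | Defs.monotone (map (fun i => X i w) s)]) w].
have InjP w : Inj w <-> injective (fun i => X i w).
  split=> h; last by move=> [i j] /= ij; rewrite (inj_eq h).
  by move=> i j e; apply/eqP/negPn/negP => /(h (i, j))/=; rewrite e eqxx.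
rewrite [X in measurable X](_ : _ = Inj `&` GP `&` Cov); last first.
  apply/seteqP; split=> w /=.
    case=> /card_range_injective xi /(general_position_orient xi) gp.
    move=> /(coverable_index _ xi)[F [FP Fm Fk]].
    split; first by split=> //; exact/InjP.
    by exists F => //; split; [exact/asboolP|exact: Fm].
  case=> -[/InjP xi gp] [F _ [/asboolP[FP Fk] Fm]]; split.
  - exact/card_range_injective.
  - exact/general_position_orient.
  - by apply/(coverable_index _ xi); exists F; split.
have m1 := measurable_coord1; have m2 := measurable_coord2.
apply: measurableI; first apply: measurableI.
- apply: (@measurable_forall_fin _ _ _ (fun t => t.1 != t.2)) => -[i j] /=.
  rewrite [X in measurable X](_ : _ =
    [set w | (X i w).1 - (X j w).1 != 0] `|`
    [set w | (X i w).2 - (X j w).2 != 0]).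
    by apply: measurableU; apply: measurable_neq0; exact: measurable_funB.
  apply/seteqP; split=> w /=; rewrite -pair_eqE /pair_eq negb_and !subr_eq0.
    by move/orP.
  by move=> h; apply/orP.
- apply: (@measurable_forall_fin _ _ _ (fun t => uniq [:: t.1.1; t.1.2; t.2])).
  move=> [[i j] l] /=; apply: measurable_neq0; apply: measurable_funB;
    by apply: measurable_funM; apply: measurable_funB.
- apply: countable_bigcupT_measurable; first exact: countableP.
  move=> F; apply: measurable_bool_and; apply: fin_bigcap_measurable => //.
  by move=> s _; exact: measurable_monotone.
Qed.

End Vertices.
End Measurability.

(** * Area of a strip *)

Section Area.
Variable R : realType.
Local Notation mu := (@lebesgue_measure R).

Lemma measurable_strip N b k a : measurable (@strip R N b k a).
Proof.
pose f p : R := N%:R * (dotp p (grid_dir R N b k) + 1).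
have mf : measurable_fun setT f.
  apply: measurable_funM => //; apply: measurable_funD => //.
  by apply: measurable_funD; apply: measurable_funM.
rewrite -[strip _ _ _ _]setTI (_ : strip N b k a = f @^-1` `[a%:R, a.+2%:R[).
  by apply: mf => //; exact: measurable_itv.
by apply/seteqP; split=> p /=; rewrite in_itv.
Qed.

Lemma measurable_unit_square : measurable (@unit_square R).
Proof. by apply: measurableX; exact: measurable_itv. Qed.

Lemma integral_unit_le (f : R -> \bar R) (e : R) :
  measurable_fun setT f -> (forall x, 0 <= f x)%E -> 0 <= e ->
  (forall x, 0 <= x <= 1 -> (f x <= e%:E)%E) ->
  (forall x, ~~ (0 <= x <= 1) -> f x = 0%E) ->
  (\int[mu]_x f x <= e%:E)%E.
Proof.
move=> mf f0 e0 fe f_out.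
have -> : (\int[mu]_x f x = \int[mu]_(x in `[0%R, 1%R]) f x)%E.
  rewrite [RHS]integral_mkcond; apply: eq_integral => x _.
  by rewrite patchE; case: ifPn => //; rewrite mem_setE in_itv /= => /f_out.
apply: (@le_trans _ _ (\int[mu]_(x in `[0%R, 1%R]) cst e%:E x)%E).
  by apply: ge0_le_integral => //; exact: measurable_funS mf.
by rewrite integral_cst//= lebesgue_measure_itv /= lte_fin ltr01 sube0 mule1.
Qed.

Lemma itv_length_le (A : set R) (c e : R) : 0 <= e -> measurable A ->
  A `<=` `[c, c + e[ -> (mu A <= e%:E)%E.
Proof.
move=> e0 mA Ae; apply: (@le_trans _ _ (mu `[c, c + e[)).
  by apply: le_measure => //; apply/mem_set.
rewrite lebesgue_measure_itv /= lte_fin ltrDl.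
case: ifP => _; last by rewrite lee_fin.
by rewrite -EFinD lee_fin; lra.
Qed.

Lemma area_xsection (A : set (R * R)) (c : R -> R) (e : R) :
  0 <= e -> measurable A ->
  (forall x y, A (x, y) -> 0 <= x <= 1 /\ c x <= y < c x + e) ->
  ((mu \x mu) A <= e%:E)%E.
Proof.
move=> e0 mA Ac; apply: integral_unit_le => //.
- exact: measurable_fun_xsection.
- move=> x x01 /=; apply: (@itv_length_le _ (c x)) => //.
    exact: measurable_xsection.
  by move=> y; rewrite /xsection /= => /set_mem/Ac[_]; rewrite in_itv.
- move=> x x01 /=; rewrite (_ : xsection A x = set0) ?measure0//.
  apply/seteqP; split=> y //; rewrite /xsection /= => /set_mem/Ac[h _].
  by rewrite h in x01.
Qed.

(** The product measure integrates the lengths of the vertical sections; by its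
uniqueness it also integrates those of the horizontal sections. *)
Lemma area_ysection (A : set (R * R)) (c : R -> R) (e : R) :
  0 <= e -> measurable A ->
  (forall x y, A (x, y) -> 0 <= y <= 1 /\ c y <= x < c y + e) ->
  ((mu \x mu) A <= e%:E)%E.
Proof.
move=> e0 mA Ac.
rewrite (@product_measure_unique _ _ _ _ _ _ _ (mu \x^ mu)%E)//; last first.
  by move=> *; exact: product_measure2E.
apply: integral_unit_le => //.
- exact: measurable_fun_ysection.
- move=> y y01 /=; apply: (@itv_length_le _ (c y)) => //.
    exact: measurable_ysection.
  by move=> x; rewrite /ysection /= => /set_mem/Ac[_]; rewrite in_itv.
- move=> y y01 /=; rewrite (_ : ysection A y = set0) ?measure0//.
  apply/seteqP; split=> x //; rewrite /ysection /= => /set_mem/Ac[h _].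
  by rewrite h in y01.
Qed.

(** For the direction [(1, t)] every horizontal section of the strip is an
interval of length [2/N], and for [(t, 1)] every vertical section is one. *)
Lemma strip_area N b k a : (0 < N)%N ->
  ((mu \x mu) (strip N b k a `&` @unit_square R) <= (2 / N%:R)%:E)%E.
Proof.
move=> N0; have NR : (0 : R) < N%:R by rewrite ltr0n.
have e0 : (0 : R) <= 2 / N%:R by rewrite divr_ge0.
have mA : measurable (strip N b k a `&` @unit_square R).
  apply: measurableI; first exact: measurable_strip.
  exact: measurable_unit_square.
have key (s t : R) : a%:R <= N%:R * (s + t + 1) < a.+2%:R ->
    a%:R / N%:R - 1 - t <= s < a%:R / N%:R - 1 - t + 2 / N%:R.
  rewrite -addn2 natrD => /andP[h1 h2].
  have {}h1 : a%:R / N%:R <= s + t + 1 by rewrite ler_pdivrMr// mulrC.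
  have {}h2 : s + t + 1 < (a%:R + 2) / N%:R by rewrite ltr_pdivlMr// mulrC.
  by rewrite mulrDl in h2; apply/andP; split; lra.
case: b mA => mA.
- pose c y : R := a%:R / N%:R - 1 - y * slope R N k.
  apply: (area_ysection (c := c)) => //.
  move=> x y [sxy /unit_squareP[/= _ hy]]; split => //; apply: key.
  by move: sxy; rewrite /strip /dotp /= mulr1.
- pose c x : R := a%:R / N%:R - 1 - x * slope R N k.
  apply: (area_xsection (c := c)) => //.
  move=> x y [sxy /unit_squareP[/= hx _]]; split => //; apply: key.
  by move: sxy; rewrite /strip /dotp /= mulr1 [x * _ + y]addrC.
Qed.

End Area.

(** * Crowded strips are unlikely *)

Section UnionBound.
Variable R : realType.

Section Mu.
Variables (d : measure_display) (T : measurableType d) (P : probability T R).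

Lemma union_bound (I : finType) (A : I -> set T) (r : R) :
  (forall i, measurable (A i)) -> (forall i, (P (A i) <= r%:E)%E) ->
  measurable (\bigcup_i A i) /\ (P (\bigcup_i A i) <= (#|I|%:R * r)%:E)%E.
Proof.
move=> mA Ar.
have -> : \bigcup_i A i = \bigcup_(i in [set` enum I]) A i.
  by apply/seteqP; split=> w [i _ Ai]; exists i => //=; rewrite mem_enum.
rewrite bigcup_seq cardT; elim: (enum I) => [|i s [IHm IH]].
  by rewrite big_nil measure0 mul0r.
rewrite big_cons; split; first exact: measurableU.
rewrite (le_trans (measureU2 _ _ _))//=.
by rewrite -add1n natrD mulrDl mul1r EFinD leeD.
Qed.

Lemma prode_le (I : finType) (J : {set I}) (f : I -> \bar R) (q : R) :
  0 <= q -> (forall i, 0 <= f i <= q%:E)%E ->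
  (0 <= \prod_(i in J) f i <= (q ^+ #|J|)%:E)%E.
Proof.
move=> q0 fq; rewrite -sum1_card.
elim/big_rec2: _ => [|i k y _ /andP[IH0 IH1]].
  by rewrite expr0 lexx lee_fin ler01.
have /andP[f0 f1] := fq i.
by rewrite mule_ge0//= add1n exprS EFinM lee_pmul.
Qed.

Variables (n : nat) (X : 'I_n -> {RV P >-> (R * R)%type}).

(** At least [m] points lie in [B]. The event is given as a union over the
[m]-element sets of indices, the form to which independence and the union bound
apply. *)
Definition crowded (m : nat) (B : set (R * R)) : set T :=
  \bigcup_(J : {J : {set 'I_n} | #|J| == m})
    \bigcap_(i in [set` sval J]) (X i @^-1` B).

Lemma measurable_event i (B : set (R * R)) :
  measurable B -> measurable (X i @^-1` B).
Proof. by move=> mB; rewrite -[_ @^-1` _]setTI; exact: measurable_funP. Qed.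

Lemma not_crowded m (B : set (R * R)) w (S : {set 'I_n}) :
  ~ crowded m B w -> {in S, forall i, B (X i w)} -> (#|S| < m)%N.
Proof.
move=> nc SB; rewrite ltnNge; apply/negP => mS; apply: nc.
have : (0 < #|[set J : {set 'I_n} | J \subset S & #|J| == m]%SET|)%N.
  by rewrite cards_draws bin_gt0.
case/card_gt0P => J; rewrite inE => /andP[/fintype.subsetP JS Jm].
by exists (exist _ J Jm) => // i /= iJ; exact/SB/JS.
Qed.

Lemma crowded_le m (B : set (R * R)) (q : R) :
  mutually_independent X -> measurable B -> 0 <= q ->
  (forall i, (P (X i @^-1` B) <= q%:E)%E) ->
  measurable (crowded m B) /\
  (P (crowded m B) <= ('C(n, m)%:R * q ^+ m)%:E)%E.
Proof.
move=> ind mB q0 Bq.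
have -> : 'C(n, m) = #|{: {J : {set 'I_n} | #|J| == m}}|.
  by rewrite card_sig -[in LHS](card_ord n) -card_draws cardsE.
apply: union_bound => -[J /= /eqP Jm].
  by apply: fin_bigcap_measurable => // i _; exact: measurable_event.
rewrite (ind J (fun=> B))// -Jm.
have fq i : (0 <= P (X i @^-1` B) <= q%:E)%E by rewrite measure_ge0 Bq.
by have /andP[] := prode_le J q0 fq.
Qed.

Hypothesis ind : mutually_independent X.
Hypothesis unif : forall i, uniform_on_square (X i).

Definition crowded_strip N m : set T :=
  \bigcup_(z : bool * 'I_(4 * N) * 'I_(4 * N))
    crowded m (strip N z.1.1 z.1.2 z.2).

Lemma crowded_strip_le N m : (0 < N)%N ->
  measurable (crowded_strip N m) /\
  (P (crowded_strip N m) <=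
    ((32 * N ^ 2)%:R * ('C(n, m)%:R * (2 / N%:R) ^+ m))%:E)%E.
Proof.
move=> N0.
have -> : (32 * N ^ 2 = #|{: bool * 'I_(4 * N) * 'I_(4 * N)}|)%N.
  by rewrite !card_prod card_bool !card_ord; lia.
have h (z : bool * 'I_(4 * N) * 'I_(4 * N)) :
    measurable (crowded m (strip N z.1.1 z.1.2 z.2)) /\
    (P (crowded m (strip N z.1.1 z.1.2 z.2)) <=
       ('C(n, m)%:R * (2 / N%:R) ^+ m)%:E)%E.
  apply: crowded_le => // [|i]; first exact: measurable_strip.
  have := unif i (measurable_strip N z.1.1 z.1.2 z.2).
  by rewrite /distribution /pushforward => ->; exact: strip_area.
by apply: union_bound => z; have [] := h z.
Qed.

Lemma outside_null i : P (X i @^-1` ~` @unit_square R) = 0%E.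
Proof.
have := unif i (measurableC (@measurable_unit_square R)).
by rewrite /distribution /pushforward => ->; rewrite setICl measure0.
Qed.

Definition outside : set T := \bigcup_(i : 'I_n) (X i @^-1` ~` @unit_square R).

Lemma outside_le : measurable outside /\ (P outside <= 0%:E)%E.
Proof.
rewrite -(mulr0 (#|'I_n|%:R)); apply: union_bound => i.
  by apply: measurable_event; apply: measurableC; exact: measurable_unit_square.
by rewrite outside_null.
Qed.

End Mu.
End UnionBound.

(** * Choice of the resolutions *)

(** A cheap form of Stirling's bound: [m ^ m] is at most the falling factorial
[(2 * m) ^_ m], which is [m`!] times a binomial coefficient
that is at most [2 ^ (2 * m)]. *)
Lemma expn_self_le_fact m : (m ^ m <= 4 ^ m * m`!)%N.
Proof.
have ffact_ge n k : ((n - k) ^ k <= n ^_ k)%N.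
  elim: k n => [n|k IH [|n]]; first by rewrite expn0 ffactn0.
    by rewrite expnS sub0n mul0n.
  rewrite ffactnS expnS subSS.
  by rewrite leq_mul// (leq_trans (leq_subr _ _)).
have bin_le n k : ('C(n, k) <= 2 ^ n)%N.
  elim: n k => [|n IH] [|k] //; first by rewrite bin0 expn_gt0.
  by rewrite binS expnS mul2n -addnn leq_add.
have := ffact_ge (2 * m)%N m; rewrite {1}mul2n -{1}addnn addnK.
move=> /leq_trans; apply.
by rewrite -bin_ffact leq_mul2r -[4%N]/(2 ^ 2)%N -expnM bin_le orbT.
Qed.

(** An integer that stands for the logarithm: it satisfies
[n < 2 ^ bit_length n], and for [n > 1] it is at most twice the logarithm. *)
Definition bit_length (n : nat) : nat := (trunc_log 2 n).+1.

(** With this choice a strip has area at most [2 * bit_length n / n]. *)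
Definition resolution (n : nat) : nat := (n %/ bit_length n).+1.

Lemma bit_length_le n : (0 < n)%N -> (bit_length n <= n)%N.
Proof.
move=> n0; have := trunc_logP (p := 2) isT n0.
by apply: leq_trans; exact: ltn_expl.
Qed.

Lemma lt_resolution_mul n : (n < resolution n * bit_length n)%N.
Proof. exact: ltn_ceil. Qed.

Lemma resolution_mul_le n :
  (0 < n)%N -> (resolution n * bit_length n <= 2 * n)%N.
Proof.
move=> n0; rewrite mul2n -addnn mulSn leq_add ?bit_length_le//.
exact: leq_trunc_div.
Qed.

Lemma resolution_le n : (0 < n)%N -> (resolution n <= 2 * n)%N.
Proof.
move=> n0; apply: leq_trans (resolution_mul_le n0).
by rewrite leq_pmulr.
Qed.

(** Write [l], [N] for the bit length and the resolution, and [m = 16 * l]. As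
[m ^ m <= 4 ^ m * m`!] and [n < N * l], the binomial coefficient is at most
[(4 * n / m) ^ m <= (N / 4) ^ m]. Of the factor [4 ^ m] gained here, [2 ^ m] pays
for the width of the strips, which is two cells, and the remaining [2 ^ m] is at
least [n ^ 16]. *)
Lemma crowded_count n : (0 < n)%N ->
  ('C(n, 16 * bit_length n) * 2 ^ (16 * bit_length n) * n ^ 3
   <= resolution n ^ (16 * bit_length n))%N.
Proof.
move=> n0; set l := bit_length n; set N := resolution n; set m := (16 * l)%N.
have l0 : (0 < l)%N by [].
have nl : (n <= 2 ^ l)%N by rewrite ltnW// trunc_log_ltn.
have binE : ('C(n, m) * m ^ m <= 4 ^ m * n ^ m)%N.
  apply: (@leq_trans ('C(n, m) * (4 ^ m * m`!))%N).
    by rewrite leq_mul2l expn_self_le_fact orbT.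
  rewrite mulnCA bin_ffact leq_mul2l; apply/orP; right.
  elim: (m) => [|k IH]; first by rewrite ffactn0.
  by rewrite ffactnSr expnSr leq_mul// leq_subr.
have {}binE : ('C(n, m) * 4 ^ m <= N ^ m)%N.
  rewrite -(@leq_pmul2r ((4 * l) ^ m)%N) ?expn_gt0 ?muln_gt0//.
  have mE : (4 * (4 * l) = m)%N by rewrite mulnA.
  rewrite -mulnA -[(4 ^ m * _)%N]expnMn mE; apply: (leq_trans binE).
  rewrite -!expnMn; case: (posnP m) => [->//|m0].
  by rewrite leq_exp2r// mulnCA leq_mul2l ltnW// lt_resolution_mul.
apply: leq_trans binE; rewrite -mulnA leq_mul2l; apply/orP; right.
rewrite -[4%N]/(2 * 2)%N expnMn leq_mul2l; apply/orP; right.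
rewrite /m mulnC expnM; apply: (@leq_trans ((2 ^ l) ^ 3)%N).
  by rewrite leq_exp2r.
by rewrite leq_pexp2l// expn_gt0.
Qed.

Section Estimates.
Variable R : realType.

Lemma bit_length_le_log2 n :
  (1 < n)%N -> (bit_length n)%:R <= 2 * log2 n%:R :> R.
Proof.
move=> n1; have n0 : (0 < n)%N by apply: ltnW.
have ln2 : 0 < ln 2 :> R by rewrite ln_gt0// ltr1n.
rewrite /log2 mulrA ler_pdivlMr//.
have h1 : (trunc_log 2 n)%:R * ln 2 <= ln n%:R :> R.
  rewrite mulrC mulr_natr -lnXn// ler_ln ?posrE ?exprn_gt0 ?ltr0n//.
  by rewrite -natrX ler_nat trunc_logP.
have h2 : ln 2 <= ln n%:R :> R by rewrite ler_ln ?posrE ?ltr0n// ler_nat.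
by rewrite /bit_length -natr1 mulrDl mul1r; lra.
Qed.

Lemma paths_le n : (1 < n)%N ->
  (16 * resolution n * (16 * bit_length n) ^ 2)%:R <=
    2 ^+ 14 * n%:R * log2 n%:R :> R.
Proof.
move=> n1; have n0 : (0 < n)%N by apply: ltnW.
have h : (16 * resolution n * (16 * bit_length n) ^ 2 <=
    2 ^ 13 * (n * bit_length n))%N.
  rewrite [X in (X <= _)%N]
    (_ : _ = 2 ^ 12 * (resolution n * bit_length n * bit_length n))%N.
    rewrite [(2 ^ 13)%N]expnSr -[(2 ^ 12 * 2 * _)%N]mulnA leq_mul2l.
    apply/orP; right.
    by rewrite mulnA leq_mul2r resolution_mul_le ?orbT.
  by rewrite expnMn -[(2 ^ 12)%N]/(16 * 16 ^ 2)%N -!mulnA; ring.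
rewrite -(ler_nat R) in h; apply: (le_trans h).
have -> : 2 ^+ 14 * n%:R * log2 n%:R = 2 ^+ 13 * (n%:R * (2 * log2 n%:R)) :> R.
  by rewrite (exprSr 2 13); move: (log2 _) (2 ^+ 13) => x y; ring.
rewrite natrM [(n * _)%:R]natrM natrX.
by rewrite !ler_wpM2l ?exprn_ge0// bit_length_le_log2.
Qed.

Lemma crowded_bits_small n : (0 < n)%N ->
  (32 * resolution n ^ 2)%:R * ('C(n, 16 * bit_length n)%:R *
     (2 / (resolution n)%:R) ^+ (16 * bit_length n)) <= 128 / n%:R :> R.
Proof.
move=> n0; have := crowded_count n0; set m := (16 * _)%N; set N := resolution n.
move: (resolution_le n0); rewrite -/N => N2.
rewrite -(ler_nat R) 2!natrM !natrX; set c := 'C(n, m)%:R => h.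
have NR : (0 : R) < N%:R by rewrite ltr0n.
have nR : (0 : R) < n%:R by rewrite ltr0n.
have N2R : (N%:R : R) ^+ 2 <= 4 * n%:R ^+ 2.
  by rewrite -[4%:R]/((2 ^ 2)%:R) natrX -exprMn -natrM lerXn2r ?nnegrE ?ler_nat.
have cE : c * (2 / N%:R) ^+ m <= n%:R ^- 3.
  rewrite expr_div_n mulrA ler_pdivrMr ?exprn_gt0// [leRHS]mulrC.
  by rewrite ler_pdivlMr ?exprn_gt0.
rewrite natrM natrX.
apply: (@le_trans _ _ (32 * (4 * n%:R ^+ 2) * n%:R ^- 3)).
  apply: ler_pM => //; first by rewrite mulr_ge0// exprn_ge0// divr_ge0.
  by rewrite ler_pM2l.
rewrite le_eqVlt; apply/orP; left; apply/eqP; field.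
by rewrite gt_eqF.
Qed.

(** At any resolution [N] the left-hand side is at most [256 * n ^ 3 / N]. *)
Lemma crowded_three_small n : (0 < n)%N ->
  (32 * (n ^ 4) ^ 2)%:R * ('C(n, 3)%:R * (2 / (n ^ 4)%:R) ^+ 3) <=
    256 / n%:R :> R.
Proof.
move=> n0; have nR : (0 : R) < n%:R by rewrite ltr0n.
have cn : ('C(n, 3)%:R : R) <= n%:R ^+ 3.
  rewrite -natrX ler_nat (@leq_trans ('C(n, 3) * 3`!)%N) ?leq_pmulr//.
  rewrite bin_ffact !ffactnSr ffactn0 mul1n !expnS expn0 muln1.
  by rewrite mulnA !leq_mul ?leq_subr.
rewrite natrM !natrX.
apply: (@le_trans _ _
    (32 * (n%:R ^+ 4) ^+ 2 * (n%:R ^+ 3 * (2 / n%:R ^+ 4) ^+ 3))).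
  have n8 : 0 <= 32 * (n%:R ^+ 4) ^+ 2 :> R.
    by rewrite mulr_ge0// !exprn_ge0// ltW.
  have n12 : 0 <= (2 / n%:R ^+ 4) ^+ 3 :> R.
    by rewrite exprn_ge0// divr_ge0// exprn_ge0// ltW.
  by apply: ler_wpM2l => //; apply: ler_wpM2r.
rewrite le_eqVlt; apply/orP; left; apply/eqP; field.
by rewrite gt_eqF.
Qed.

End Estimates.

(** * The good event *)

Section Tail.
Variables (R : realType) (d : measure_display) (T : measurableType d).
Variables (P : probability T R) (n : nat) (X : 'I_n -> {RV P >-> (R * R)%type}).
Hypothesis ind : mutually_independent X.
Hypothesis unif : forall i, uniform_on_square (X i).

Definition good_event : set T :=
  [set w | let A := range (fun i : 'I_n => X i w) in
    [/\ (A #= `I_n)%card, general_position A &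
        monotone_coverable A (2 ^+ 14 * n%:R * log2 n%:R)]].

Lemma measurable_good_event : measurable good_event.
Proof. by apply: measurable_good => i; exact: measurable_funP. Qed.

Lemma not_good_sub : (2 < n)%N ->
  ~` good_event `<=` outside X `|`
    (crowded_strip X (resolution n) (16 * bit_length n) `|`
     crowded_strip X (n ^ 4) 3).
Proof.
move=> n2; apply: subsetCl; rewrite !setCU => w [out [few1 few2]].
have n0 : (0 < n)%N by apply: leq_ltn_trans n2.
have inside i : unit_square (X i w).
  by apply: contrapT => h; apply: out; exists i.
have sparse N m : ~ crowded_strip X N m w -> sparse_strips (fun i => X i w) N m.
  move=> h b k a; apply: (@not_crowded _ _ _ _ _ X m (strip N b k a) w).
    by move=> c; apply: h; exists (b, k, a).
  by move=> i /strip_membersP.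
have n4 : (0 < n ^ 4)%N by rewrite expn_gt0 n0.
have [x_inj gp] := sparse3_general_position n2 n4 inside (sparse _ _ few2).
split => //; first exact/card_range_injective.
have [F [FP Fc Fk]] :=
  sparse_coverable (ltn0Sn _) x_inj inside (sparse _ _ few1).
by exists F; split => //; apply: (le_trans Fk); apply: paths_le; exact: ltnW.
Qed.

Lemma good_event_prob : (2 < n)%N -> ((1 - 384 / n%:R)%:E <= P good_event)%E.
Proof.
move=> n2; have n0 : (0 < n)%N by apply: leq_ltn_trans n2.
have [m0 P0] := outside_le unif.
have [m1 P1] := crowded_strip_le ind unif (16 * bit_length n)%N
  (ltn0Sn (n %/ bit_length n)).
have n4 : (0 < n ^ 4)%N by rewrite expn_gt0 n0.
have [m2 P2] := crowded_strip_le ind unif 3 n4.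
have mG := measurable_good_event.
have bad : (P (~` good_event) <= (384 / n%:R)%:E)%E.
  have m12 := measurableU _ _ m1 m2.
  apply: le_trans (le_measure P _ _ (not_good_sub n2)) _.
  - exact/mem_set/measurableC.
  - exact/mem_set/measurableU.
  apply: (le_trans (measureU2 _ m0 m12)); rewrite -[leRHS]add0e.
  apply: leeD => //.
  apply: (le_trans (measureU2 _ m1 m2)).
  have -> : 384 / n%:R = 128 / n%:R + 256 / n%:R :> R.
    by rewrite -mulrDl; congr (_ / _); ring.
  rewrite EFinD; apply: leeD.
    by apply: (le_trans P1); rewrite lee_fin; exact: crowded_bits_small.
  by apply: (le_trans P2); rewrite lee_fin; exact: crowded_three_small.
rewrite -[good_event]setCK probability_setC; last exact: measurableC.
by rewrite EFinB leeB.
Qed.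

End Tail.

Theorem mainTheorem2 (R : realType) :
  exists C : R, 0 < C /\
  forall (d : nat -> measure_display) (T : forall n : nat, measurableType (d n))
         (P : forall n : nat, probability (T n) R)
         (X : forall n : nat, 'I_n -> {RV (P n) >-> (R * R)%type}),
    (forall n : nat, mutually_independent (X n)) ->
    (forall (n : nat) (i : 'I_n), uniform_on_square (X n i)) ->
    let good (n : nat) : set (T n) :=
      [set w | let A := range (fun i : 'I_n => X n i w) in
        [/\ (A #= `I_n)%card, general_position A &
            monotone_coverable A (C * n%:R * log2 n%:R)]] in
    (forall n : nat, measurable (good n)) /\
    P n (good n) @[n --> \oo] --> 1%E.
Proof.
exists (2 ^+ 14); split; first by rewrite exprn_gt0.
move=> d T P X ind unif good; split=> [n|]; first exact: measurable_good_event.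
apply: (@squeeze_cvge _ _ _ _ (fun n => (1 - 384 / n%:R)%:E) _ (fun=> 1%E)).
- near=> n; apply/andP; split; last first.
    by apply: probability_le1; exact: measurable_good_event.
  apply: good_event_prob; [exact: ind|exact: unif|].
  by near: n; exact: nbhs_infty_gt.
- apply: cvg_EFin; first exact: nearW.
  rewrite -[X in _ --> X]subr0 -[X in _ - X](mulr0 384).
  apply: cvgB; first exact: cvg_cst.
  apply: cvgM; first exact: cvg_cst.
  apply/gtr0_cvgV0; last exact: cvgr_idn.
  by near=> n; rewrite ltr0n; near: n; exact: nbhs_infty_gt.
- exact: cvg_cst.
Unshelve. all: by end_near. Qed.
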